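(* Let $\Omega\subset\mathbb{H}$ be a spectrally saturated set, and let $U=\mathfrak{S}(\Omega)$. The map $$\mathcal{S}(U,\mathbb{M})\ni F\mapsto F_{\mathbb{H}}\in\mathcal{F}(\Omega,\mathbb{H})$$ is $\mathbb{R}$-linear, injective, and has the property $(Ff)_{\mathbb{H}}=F_{\mathbb{H}}f_{\mathbb{H}}$ for all $F\in\mathcal{S}(U,\mathbb{M})$ and $f\in\mathcal{S}(U)$. Moreover, the restricted map $$\mathcal{S}(U)\ni f\mapsto f_{\mathbb{H}}\in\mathcal{F}(\Omega,\mathbb{H})$$ is unital and multiplicative.
   Context: $\mathbb{H}$ is the real algebra of quaternions $\mathbf{x}=x_0+x_1\mathbf{j}+x_2\mathbf{k}+x_3\mathbf{l}$ (imaginary units $\mathbf{j},\mathbf{k},\mathbf{l}$), with Euclidean norm $\|\cdot\|$, real part $\Re\mathbf{x}=x_0$ and imaginary part $\Im\mathbf{x}=x_1\mathbf{j}+x_2\mathbf{k}+x_3\mathbf{l}$. $\mathbb{M}=\mathbb{C}\otimes_{\mathbb{R}}\mathbb{H}=\mathbb{H}+i\mathbb{H}$ is its complexification, a complex algebra in which the complex unit $i$ (independent of $\mathbf{j},\mathbf{k},\mathbf{l}$) commutes with $\mathbb{H}$; it contains $\mathbb{C}$ and $\mathbb{H}$. The conjugation of $\mathbb{M}$ is $\overline{\mathbf{b}+i\mathbf{c}}=\mathbf{b}-i\mathbf{c}$ for $\mathbf{b},\mathbf{c}\in\mathbb{H}$; on $\mathbb{C}$ it is complex conjugation. For $\mathbf{q}\in\mathbb{H}$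 put $s_\pm(\mathbf{q})=\Re\mathbf{q}\pm i\|\Im\mathbf{q}\|\in\mathbb{C}$ and $\sigma(\mathbf{q})=\{s_+(\mathbf{q}),s_-(\mathbf{q})\}$ (the spectrum of $\mathbf{q}$ in $\mathbb{M}$). A set $\Omega\subset\mathbb{H}$ is spectrally saturated if whenever $\mathbf{h}\in\mathbb{H}$, $\mathbf{q}\in\Omega$ and $\sigma(\mathbf{h})=\sigma(\mathbf{q})$, then $\mathbf{h}\in\Omega$. Put $\mathfrak{S}(\Omega)=\bigcup_{\mathbf{q}\in\Omega}\sigma(\mathbf{q})\subset\mathbb{C}$. For $U\subset\mathbb{C}$ put $U_{\mathbb{H}}=\{\mathbf{q}\in\mathbb{H}:\sigma(\mathbf{q})\subset U\}$. If $\Omega$ is spectrally saturated and $U=\mathfrak{S}(\Omega)$, then $U$ is conjugate symmetric (i.e. $\zeta\in U\iff\bar\zeta\in U$) and $U_{\mathbb{H}}=\Omega$. For conjugate symmetric $U$: $\mathcal{S}(U,\mathbb{M})$ is the real vector space of all $\mathbb{M}$-valued stem functions on $U$, i.e. functions $F:U\to\mathbb{M}$ with $F(\bar\zeta)=\overline{F(\zeta)}$ for all $\zeta\in U$; $\mathcal{S}(U)$ is the real algebra of all $\mathbb{C}$-valued stem functions on $U$. $\mathcal{F}(\Omega,\mathbb{H})$ is the set of all $\mathbb{H}$-valued functions on $\Omega$, with pointwise operations. For $F:U\to\mathbb{M}$, the function $F_{\mathbb{H}}:U_{\mathbb{H}}\to\mathbb{M}$ is defined by $$F_{\mathbb{H}}(\mathbf{q})=F(s_+(\mathbf{q}))\,\iota_+(\mathfrak{s})+F(s_-(\mathbf{q}))\,\iota_-(\mathfrak{s}),\qquad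 \mathfrak{s}=\frac{\Im\mathbf{q}}{\|\Im\mathbf{q}\|},\quad \iota_\pm(\mathfrak{s})=\tfrac12(1\mp i\mathfrak{s}),$$ when $\Im\mathbf{q}\ne0$, and $F_{\mathbb{H}}(\mathbf{q})=F(\mathbf{q})$ when $\mathbf{q}\in\mathbb{R}$. (When $F$ is a stem function, $F_{\mathbb{H}}$ takes values in $\mathbb{H}$.) *)

(* Defs.v *)
From HB Require Import structures.
From mathcomp Require Import all_boot all_order all_algebra.
From mathcomp Require Import ring.
From mathcomp Require Import boolp classical_sets functions reals.
From mathcomp Require Import complex.

Set Implicit Arguments.
Unset Strict Implicit.
Unset Printing Implicit Defensive.

Import Order.TTheory GRing.Theory Num.Theory.

Local Open Scope classical_set_scope.
Local Open Scope ring_scope.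

Record quaternion (R : Type) :=
  Quaternion { qre : R; qj : R; qk : R; ql : R }.

Section QuaternionAlgebra.
Variable R : comNzRingType.
Local Notation H := (quaternion R).
Implicit Types p q r : H.

Definition quat_tuple q := (qre q, qj q, qk q, ql q).
Definition tuple_quat (t : R * R * R * R) : H :=
  Quaternion t.1.1.1 t.1.1.2 t.1.2 t.2.
Lemma quat_tupleK : cancel quat_tuple tuple_quat. Proof. by case. Qed.
HB.instance Definition _ := Choice.copy H (can_type quat_tupleK).

Definition quat_zero : H := Quaternion 0 0 0 0.
Definition quat_one : H := Quaternion 1 0 0 0.
Definition quat_opp p : H := Quaternion (- qre p) (- qj p) (- qk p) (- ql p).
Definition quat_add p q : H :=
  Quaternion (qre p + qre q) (qj p + qj q) (qk p + qk q) (ql p + ql q).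
(* j^2 = k^2 = l^2 = -1, jk = l = -kj, kl = j = -lk, lj = k = -jl *)
Definition quat_mul p q : H :=
  Quaternion
    (qre p * qre q - qj p * qj q - qk p * qk q - ql p * ql q)
    (qre p * qj q + qj p * qre q + qk p * ql q - ql p * qk q)
    (qre p * qk q - qj p * ql q + qk p * qre q + ql p * qj q)
    (qre p * ql q + qj p * qk q - qk p * qj q + ql p * qre q).
Definition quat_scale (a : R) p : H :=
  Quaternion (a * qre p) (a * qj p) (a * qk p) (a * ql p).

Lemma quat_addA : associative quat_add.
Proof. by move=> [? ? ? ?] [? ? ? ?] [? ? ? ?]; congr Quaternion => /=; ring. Qed.
Lemma quat_addC : commutative quat_add.
Proof. by move=> [? ? ? ?] [? ? ? ?]; congr Quaternion => /=; ring. Qed.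
Lemma quat_add0 : left_id quat_zero quat_add.
Proof. by move=> [? ? ? ?]; congr Quaternion => /=; ring. Qed.
Lemma quat_addN : left_inverse quat_zero quat_opp quat_add.
Proof. by move=> [? ? ? ?]; congr Quaternion => /=; ring. Qed.
HB.instance Definition _ :=
  GRing.isZmodule.Build H quat_addA quat_addC quat_add0 quat_addN.

Lemma quat_mulA : associative quat_mul.
Proof. by move=> [? ? ? ?] [? ? ? ?] [? ? ? ?]; congr Quaternion => /=; ring. Qed.
Lemma quat_mul1l : left_id quat_one quat_mul.
Proof. by move=> [? ? ? ?]; congr Quaternion => /=; ring. Qed.
Lemma quat_mul1r : right_id quat_one quat_mul.
Proof. by move=> [? ? ? ?]; congr Quaternion => /=; ring. Qed.
Lemma quat_mulDl : left_distributive quat_mul quat_add.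
Proof. by move=> [? ? ? ?] [? ? ? ?] [? ? ? ?]; congr Quaternion => /=; ring. Qed.
Lemma quat_mulDr : right_distributive quat_mul quat_add.
Proof. by move=> [? ? ? ?] [? ? ? ?] [? ? ? ?]; congr Quaternion => /=; ring. Qed.
Lemma quat_oner_neq0 : quat_one != 0.
Proof. by apply/eqP => -[] /eqP; rewrite oner_eq0. Qed.
HB.instance Definition _ := GRing.Zmodule_isNzRing.Build H
  quat_mulA quat_mul1l quat_mul1r quat_mulDl quat_mulDr quat_oner_neq0.

Lemma quat_scaleA a b p : quat_scale a (quat_scale b p) = quat_scale (a * b) p.
Proof. by congr Quaternion => /=; ring. Qed.
Lemma quat_scale1 : left_id 1 quat_scale.
Proof. by move=> [? ? ? ?]; congr Quaternion => /=; ring. Qed.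
Lemma quat_scaleDr : right_distributive quat_scale +%R.
Proof. by move=> ? [? ? ? ?] [? ? ? ?]; congr Quaternion => /=; ring. Qed.
Lemma quat_scaleDl p : {morph quat_scale^~ p : a b / a + b}.
Proof. by move=> ? ?; congr Quaternion => /=; ring. Qed.
HB.instance Definition _ := GRing.Zmodule_isLmodule.Build R H
  quat_scaleA quat_scale1 quat_scaleDr quat_scaleDl.

Lemma quat_scaleAl (a : R) p q : a *: (p * q) = (a *: p) * q.
Proof. by congr Quaternion => /=; ring. Qed.
HB.instance Definition _ := GRing.Lmodule_isLalgebra.Build R H quat_scaleAl.
Lemma quat_scaleAr (a : R) p q : a *: (p * q) = p * (a *: q).
Proof. by congr Quaternion => /=; ring. Qed.
HB.instance Definition _ := GRing.Lalgebra_isAlgebra.Build R H quat_scaleAr.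

End QuaternionAlgebra.

(* CQuaternion b c is b + i c, with b, c quaternions and i central, i^2 = -1 *)
Record cquaternion (R : Type) :=
  CQuaternion { cqre : quaternion R; cqim : quaternion R }.

Section ComplexQuaternionAlgebra.
Variable R : comNzRingType.
Local Notation H := (quaternion R).
Local Notation M := (cquaternion R).
Implicit Types x y z : M.

Definition cquat_pair x := (cqre x, cqim x).
Definition pair_cquat (t : H * H) : M := CQuaternion t.1 t.2.
Lemma cquat_pairK : cancel cquat_pair pair_cquat. Proof. by case. Qed.
HB.instance Definition _ := Choice.copy M (can_type cquat_pairK).

Definition cquat_zero : M := CQuaternion 0 0.
Definition cquat_one : M := CQuaternion 1 0.
Definition cquat_opp x : M := CQuaternion (- cqre x) (- cqim x).
Definition cquat_add x y : M :=
  CQuaternion (cqre x + cqre y) (cqim x + cqim y).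
Definition cquat_mul x y : M :=
  CQuaternion (cqre x * cqre y - cqim x * cqim y)
              (cqre x * cqim y + cqim x * cqre y).
Definition cquat_scale (a : R) x : M := CQuaternion (a *: cqre x) (a *: cqim x).

Lemma cquat_addA : associative cquat_add.
Proof. by move=> [? ?] [? ?] [? ?]; congr CQuaternion; rewrite /= addrA. Qed.
Lemma cquat_addC : commutative cquat_add.
Proof. by move=> [? ?] [? ?]; congr CQuaternion; rewrite /= addrC. Qed.
Lemma cquat_add0 : left_id cquat_zero cquat_add.
Proof. by move=> [? ?]; congr CQuaternion; rewrite /= add0r. Qed.
Lemma cquat_addN : left_inverse cquat_zero cquat_opp cquat_add.
Proof. by move=> [? ?]; congr CQuaternion; rewrite /= addNr. Qed.
HB.instance Definition _ :=
  GRing.isZmodule.Build M cquat_addA cquat_addC cquat_add0 cquat_addN.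

Lemma cquat_mulA : associative cquat_mul.
Proof.
move=> [a b] [c d] [e f]; congr CQuaternion => /=;
  rewrite !(mulrBr, mulrDr, mulrBl, mulrDl) !mulrA ?opprD !addrA.
all: by rewrite [LHS]addrAC; congr (_ + _); rewrite addrAC.
Qed.
Lemma cquat_mul1l : left_id cquat_one cquat_mul.
Proof. by move=> [? ?]; congr CQuaternion; rewrite /= !(mul1r, mul0r) ?subr0 ?addr0. Qed.
Lemma cquat_mul1r : right_id cquat_one cquat_mul.
Proof. by move=> [? ?]; congr CQuaternion; rewrite /= !(mulr1, mulr0) ?subr0 ?add0r. Qed.
Lemma cquat_mulDl : left_distributive cquat_mul cquat_add.
Proof.
move=> [? ?] [? ?] [? ?].
by congr CQuaternion; rewrite /= !mulrDl ?opprD addrACA.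
Qed.
Lemma cquat_mulDr : right_distributive cquat_mul cquat_add.
Proof.
move=> [? ?] [? ?] [? ?].
by congr CQuaternion; rewrite /= !mulrDr ?opprD addrACA.
Qed.
Lemma cquat_oner_neq0 : cquat_one != 0.
Proof. by apply/eqP => -[] /eqP; rewrite oner_eq0. Qed.
HB.instance Definition _ := GRing.Zmodule_isNzRing.Build M
  cquat_mulA cquat_mul1l cquat_mul1r cquat_mulDl cquat_mulDr cquat_oner_neq0.

Lemma cquat_scaleA a b x : cquat_scale a (cquat_scale b x) = cquat_scale (a * b) x.
Proof. by congr CQuaternion; rewrite /= scalerA. Qed.
Lemma cquat_scale1 : left_id 1 cquat_scale.
Proof. by move=> [? ?]; congr CQuaternion; rewrite /= scale1r. Qed.
Lemma cquat_scaleDr : right_distributive cquat_scale +%R.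
Proof. by move=> ? [? ?] [? ?]; congr CQuaternion; rewrite /= scalerDr. Qed.
Lemma cquat_scaleDl x : {morph cquat_scale^~ x : a b / a + b}.
Proof. by move=> ? ?; congr CQuaternion; rewrite /= scalerDl. Qed.
HB.instance Definition _ := GRing.Zmodule_isLmodule.Build R M
  cquat_scaleA cquat_scale1 cquat_scaleDr cquat_scaleDl.

Lemma cquat_scaleAl (a : R) x y : a *: (x * y) = (a *: x) * y.
Proof.
by congr CQuaternion; rewrite /= ?scalerBr ?scalerDr !scalerAl.
Qed.
HB.instance Definition _ := GRing.Lmodule_isLalgebra.Build R M cquat_scaleAl.
Lemma cquat_scaleAr (a : R) x y : a *: (x * y) = x * (a *: y).
Proof.
by congr CQuaternion; rewrite /= ?scalerBr ?scalerDr !scalerAr.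
Qed.
HB.instance Definition _ := GRing.Lalgebra_isAlgebra.Build R M cquat_scaleAr.

Definition cquat_conj x : M := CQuaternion (cqre x) (- cqim x).

Definition quat_to_cquat (q : H) : M := CQuaternion q 0.

Definition complex_to_cquat (z : R[i]) : M :=
  CQuaternion (complex.Re z)%:A (complex.Im z)%:A.

Lemma quat_to_cquat_is_additive : zmod_morphism quat_to_cquat.
Proof. by move=> p q; congr CQuaternion; rewrite /= oppr0 addr0. Qed.
Lemma quat_to_cquat_is_monoid_morphism : monoid_morphism quat_to_cquat.
Proof.
split=> // p q; congr CQuaternion; rewrite /=.
  by rewrite mulr0 subr0.
by rewrite mulr0 mul0r addr0.
Qed.
HB.instance Definition _ := GRing.isZmodMorphism.Build H M quat_to_cquat
  quat_to_cquat_is_additive.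
HB.instance Definition _ := GRing.isMonoidMorphism.Build H M quat_to_cquat
  quat_to_cquat_is_monoid_morphism.

Lemma cquat_conj_is_additive : zmod_morphism cquat_conj.
Proof. by move=> x y; congr CQuaternion; rewrite /= opprB addrC ?opprK. Qed.
Lemma cquat_conj_is_monoid_morphism : monoid_morphism cquat_conj.
Proof.
by split=> [|x y]; congr CQuaternion; rewrite /= ?oppr0 ?mulrNN // mulrN mulNr opprD.
Qed.
Lemma cquat_conj_is_scalable : scalable cquat_conj.
Proof. by move=> a x; congr CQuaternion; rewrite /= scalerN. Qed.
HB.instance Definition _ := GRing.isZmodMorphism.Build M M cquat_conj
  cquat_conj_is_additive.
HB.instance Definition _ := GRing.isMonoidMorphism.Build M M cquat_conj
  cquat_conj_is_monoid_morphism.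
HB.instance Definition _ := GRing.isScalable.Build R M M *:%R cquat_conj
  cquat_conj_is_scalable.

End ComplexQuaternionAlgebra.

Section Spectrum.
Variable R : realType.
Local Notation H := (quaternion R).
Implicit Types (q h : H) (Omega : set H) (U : set R[i]).

Definition quat_norm q : R :=
  Num.sqrt (qre q ^+ 2 + qj q ^+ 2 + qk q ^+ 2 + ql q ^+ 2).

(* the imaginary part is again a quaternion *)
Definition quat_im q : H := Quaternion 0 (qj q) (qk q) (ql q).

Definition s_plus q : R[i] := Complex (qre q) (quat_norm (quat_im q)).
Definition s_minus q : R[i] := Complex (qre q) (- quat_norm (quat_im q)).

Definition spectrum q : set R[i] := [set s_plus q; s_minus q].

Definition spectrally_saturated Omega : Prop :=
  forall h q, Omega q -> spectrum h = spectrum q -> Omega h.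

Definition spectral_image Omega : set R[i] := \bigcup_(q in Omega) spectrum q.

Definition spectral_domain U : set H := [set q | spectrum q `<=` U].

Lemma conjc_s_plus q : conjc (s_plus q) = s_minus q. Proof. by []. Qed.

Lemma spectral_image_conj Omega z :
  spectral_image Omega z <-> spectral_image Omega (conjc z).
Proof.
have imp w : spectral_image Omega w -> spectral_image Omega (conjc w).
  by case=> q Oq [->|->]; exists q => //;
    [right; rewrite conjc_s_plus | left; rewrite -conjc_s_plus conjcK].
by split=> [/imp //|/imp]; rewrite conjcK.
Qed.

Lemma sub_spectral_domain Omega : Omega `<=` spectral_domain (spectral_image Omega).
Proof. by move=> q Oq z qz; exists q. Qed.

Lemma spectral_domainK Omega : spectrally_saturated Omega ->
  spectral_domain (spectral_image Omega) = Omega.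
Proof.
move=> satO; apply/seteqP; split; last exact: sub_spectral_domain.
move=> q /(_ (s_plus q)) [|p Op sqp]; first by left.
apply: (satO _ p) => //; rewrite /spectrum.
rewrite -!conjc_s_plus; case: sqp => ->; first by rewrite conjc_s_plus.
by rewrite -conjc_s_plus conjcK setUC.
Qed.

End Spectrum.

Section ComplexEmbedding.
Variable R : realType.

Lemma complex_to_cquat_is_additive : zmod_morphism (@complex_to_cquat R).
Proof.
by move=> [a b] [c d]; congr CQuaternion; rewrite /= scalerBl.
Qed.
Lemma complex_to_cquat_is_monoid_morphism :
  monoid_morphism (@complex_to_cquat R).
Proof.
split=> [|[a b] [c d]]; congr CQuaternion; congr Quaternion => /=; ring.
Qed.
HB.instance Definition _ := GRing.isZmodMorphism.Build R[i] (cquaternion R)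
  (@complex_to_cquat R) complex_to_cquat_is_additive.
HB.instance Definition _ := GRing.isMonoidMorphism.Build R[i] (cquaternion R)
  (@complex_to_cquat R) complex_to_cquat_is_monoid_morphism.

End ComplexEmbedding.

Section SliceExtension.
Variable R : realType.
Local Notation H := (quaternion R).
Local Notation M := (cquaternion R).
Variable U : set R[i].

Lemma s_plus_mem (q : spectral_domain U) : s_plus (val q) \in U.
Proof. by apply/mem_set; apply: (set_mem (valP q)); left. Qed.

Lemma s_minus_mem (q : spectral_domain U) : s_minus (val q) \in U.
Proof. by apply/mem_set; apply: (set_mem (valP q)); right. Qed.

Definition s_plus_in (q : spectral_domain U) : U := SigSub (s_plus_mem q).
Definition s_minus_in (q : spectral_domain U) : U := SigSub (s_minus_mem q).

Definition iota_plus (s : H) : M :=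
  2^-1 *: (1 - complex_to_cquat 'i%C * quat_to_cquat s).
Definition iota_minus (s : H) : M :=
  2^-1 *: (1 + complex_to_cquat 'i%C * quat_to_cquat s).

Lemma iota_conj_sum_im (x : M) (s : H) :
  cqim (x * iota_plus s + cquat_conj x * iota_minus s) = 0.
Proof.
rewrite /iota_plus /iota_minus.
case: x s => [[? ? ? ?] [? ? ? ?]] [? ? ? ?].
by move: (2^-1 : R) => ?; congr Quaternion => /=; ring.
Qed.

(* when the imaginary part of q is zero, s_plus q is q as a point of C *)
Definition slice_ext (F : U -> M) (q : spectral_domain U) : M :=
  let v := quat_im (val q) in
  let s := (quat_norm v)^-1 *: v in
  if v == 0 then F (s_plus_in q)
  else F (s_plus_in q) * iota_plus s + F (s_minus_in q) * iota_minus s.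

End SliceExtension.

Section StemFunctions.
Variable R : realType.
Local Notation H := (quaternion R).
Local Notation M := (cquaternion R).
Variable U : set R[i].

(* For conjugate symmetric U this is F (conj z) = conj (F z) for all z in U;
   w stands for conj z, as an element of the type of points of U. *)
Definition is_stem (V : Type) (conj : V -> V) : {pred U -> V} :=
  fun F => `[< forall z w : U, val w = conjc (val z) -> F w = conj (F z) >].

Definition stemM_pred := is_stem (@cquat_conj R).
Definition stemC_pred := is_stem (@conjc R).

Record stemM := StemM { stemM_val :> U -> M; _ : stemM_val \in stemM_pred }.
HB.instance Definition _ := [isSub for stemM_val].
HB.instance Definition _ := [Choice of stemM by <:].

Record stemC := StemC { stemC_val :> U -> R[i]; _ : stemC_val \in stemC_pred }.
HB.instance Definition _ := [isSub for stemC_val].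
HB.instance Definition _ := [Choice of stemC by <:].

Lemma stemM_subring : subring_closed stemM_pred.
Proof.
split.
- by apply/asboolP => z w _; rewrite rmorph1.
- move=> F G /asboolP hF /asboolP hG; apply/asboolP => z w zw.
  by rewrite -[LHS]/(F w - G w) (hF z w zw) (hG z w zw) -rmorphB.
- move=> F G /asboolP hF /asboolP hG; apply/asboolP => z w zw.
  by rewrite -[LHS]/(F w * G w) (hF z w zw) (hG z w zw) -rmorphM.
Qed.
HB.instance Definition _ := GRing.isSubringClosed.Build _ stemM_pred stemM_subring.
HB.instance Definition _ := GRing.SubChoice_isSubPzRing.Build _ stemM_pred stemM
  stemM_subring.

Lemma stemM_scaler : GRing.scaler_closed stemM_pred.
Proof.
move=> a F /asboolP hF; apply/asboolP => z w zw.
by rewrite -[LHS]/(a *: F w) (hF z w zw) -linearZ.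
Qed.
HB.instance Definition _ := GRing.isScaleClosed.Build _ _ stemM_pred stemM_scaler.
HB.instance Definition _ := [SubZmodule_isSubLmodule of stemM by <:].

Lemma stemC_subring : subring_closed stemC_pred.
Proof.
split.
- by apply/asboolP => z w _; rewrite rmorph1.
- move=> F G /asboolP hF /asboolP hG; apply/asboolP => z w zw.
  by rewrite -[LHS]/(F w - G w) (hF z w zw) (hG z w zw) -rmorphB.
- move=> F G /asboolP hF /asboolP hG; apply/asboolP => z w zw.
  by rewrite -[LHS]/(F w * G w) (hF z w zw) (hG z w zw) -rmorphM.
Qed.
HB.instance Definition _ := GRing.isSubringClosed.Build _ stemC_pred stemC_subring.
HB.instance Definition _ := GRing.SubChoice_isSubPzRing.Build _ stemC_pred stemC
  stemC_subring.

Lemma stem_incl_subproof (f : stemC) :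
  (fun z : U => complex_to_cquat (f z)) \in stemM_pred.
Proof.
apply/asboolP => z w zw; have /asboolP hf := valP f.
rewrite (hf z w zw); rewrite /=; case: (f z) => a b.
by congr CQuaternion; rewrite /= ?scaleNr.
Qed.

(* S(U) as a subset of S(U, M), through the inclusion of C in M *)
Definition stem_incl (f : stemC) : stemM := StemM (stem_incl_subproof f).

Lemma slice_ext_im (F : stemM) (q : spectral_domain U) : cqim (slice_ext F q) = 0.
Proof.
have /asboolP hF := valP F; rewrite /slice_ext; case: ifP => [/eqP im0|_].
  have s0 : val (s_plus_in q) = conjc (val (s_plus_in q)).
    by rewrite /= /s_plus im0 /quat_norm /= !expr0n /= !addr0 sqrtr0 oppr0.
  have /(congr1 (@cqim R)) /= /eqP := hF _ _ s0.
  case: (cqim _) => a b c d /eqP [] /eqP + /eqP + /eqP + /eqP.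
  by rewrite -!addr_eq0 -!mulr2n !mulrn_eq0 /= => /eqP -> /eqP -> /eqP -> /eqP ->.
rewrite (hF (s_plus_in q) (s_minus_in q)) //.
exact: iota_conj_sum_im.
Qed.

End StemFunctions.

Section StemMap.
Variable R : realType.
Variable Omega : set (quaternion R).
Local Notation U := (spectral_image Omega).

(* The inclusion of Omega in spectral_domain U, which is an equality when Omega
   is spectrally saturated (spectral_domainK). *)
Definition to_spectral_domain (q : Omega) : spectral_domain U :=
  SigSub (mem_set (sub_spectral_domain (set_mem (valP q)))).

(* By stem_mapE the slice extension of a stem function takes values in the
   quaternions, so taking the quaternion part loses nothing. *)
Definition stem_map (F : stemM U) : Omega -> quaternion R :=
  fun q => cqre (slice_ext F (to_spectral_domain q)).

Lemma stem_mapE (F : stemM U) (q : Omega) :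
  quat_to_cquat (stem_map F q) = slice_ext F (to_spectral_domain q).
Proof.
rewrite /stem_map; have := slice_ext_im F (to_spectral_domain q).
by case: slice_ext => b c /= ->.
Qed.

End StemMap.

(* Main.v *)
Require Import Defs.
From mathcomp Require Import all_boot all_order all_algebra.
From mathcomp Require Import ring.
From mathcomp Require Import boolp classical_sets functions reals complex.

Set Implicit Arguments.
Unset Strict Implicit.
Unset Printing Implicit Defensive.

Import Order.TTheory GRing.Theory Num.Theory.
Local Open Scope classical_set_scope.
Local Open Scope ring_scope.

(** Away from the real axis, [s], the normalized imaginary part of [q], squares
    to [-1]; hence [i s] squares to [1] in the complexified quaternions, and
    [iota_plus s], [iota_minus s] are complementary orthogonal idempotents.

    Multiplicativity is then a computation in a two-point functional calculus:
    if [c], [d] are central, then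
      (x iota_+ + y iota_-) (c iota_+ + d iota_-) = x c iota_+ + y d iota_-
    ([slice_product]), and the values of a complex stem function are central
    ([complex_to_cquat_central]).  For noncentral [c], [d] this fails in
    general, which is why one of the two factors is complex valued.

    Injectivity comes from an inversion formula.  Replacing [q] by its
    quaternionic conjugate [q'] keeps [s_plus] and [s_minus], and exchanges the
    two idempotents, so
      F (s_plus q) = F_H q iota_+ + F_H q' iota_-
    ([slice_ext_inversion]).  Spectral saturation is what guarantees that [q']
    is again in [Omega], so that [F_H] determines [F] at [s_plus q]; the stem
    symmetry then determines [F] at [s_minus q]. *)

(** * The idempotents attached to an imaginary unit *)

Section Idempotents.
Variable R : realType.
Implicit Types (s : quaternion R) (x y c d : cquaternion R).

Lemma complex_to_cquat_central (z : R[i]) x :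
  complex_to_cquat z * x = x * complex_to_cquat z.
Proof.
case: z x => a b [p q].
by congr CQuaternion; rewrite /= !mulr_algl !mulr_algr // addrC.
Qed.

Lemma iota_sum s : iota_plus s + iota_minus s = 1.
Proof.
rewrite /iota_plus /iota_minus -scalerDr addrACA addNr addr0 -mulr2n.
by rewrite -scaler_nat scalerA mulVf ?scale1r // pnatr_eq0.
Qed.

Lemma iota_plusN s : iota_plus (- s) = iota_minus s.
Proof. by rewrite /iota_plus /iota_minus rmorphN mulrN opprK. Qed.

Lemma iota_minusN s : iota_minus (- s) = iota_plus s.
Proof. by rewrite -iota_plusN opprK. Qed.

(** For an imaginary unit [s], the element [t = i s] satisfies [t t = 1], so
    that the product is a quarter of [(1 - t) (1 + t) = 1 - t t = 0]. *)
Lemma iota_plus_minus s : s * s = -1 -> iota_plus s * iota_minus s = 0.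
Proof.
move=> ss; rewrite /iota_plus /iota_minus -scalerAl -scalerAr.
set t := _ * quat_to_cquat s.
have t_sqr : t * t = 1.
  rewrite /t {2}complex_to_cquat_central mulrA -[X in X * _]mulrA -rmorphM ss.
  rewrite rmorphN1 mulrN1 mulNr -rmorphM -expr2 sqr_i.
  by rewrite rmorphN1 opprK.
rewrite mulrDr mulr1 mulrBl mul1r t_sqr.
by rewrite addrA subrK subrr !scaler0.
Qed.

Lemma iota_minus_plus s : s * s = -1 -> iota_minus s * iota_plus s = 0.
Proof.
by move=> ss; rewrite -(iota_minusN s) -iota_plusN iota_plus_minus ?mulrNN.
Qed.

Lemma iota_plus_idem s : s * s = -1 -> iota_plus s * iota_plus s = iota_plus s.
Proof.
move=> /iota_plus_minus ss.
by rewrite -[RHS]mulr1 -(iota_sum s) mulrDr ss addr0.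
Qed.

Lemma iota_minus_idem s :
  s * s = -1 -> iota_minus s * iota_minus s = iota_minus s.
Proof. by move=> ss; rewrite -iota_plusN iota_plus_idem ?mulrNN. Qed.

(** Moving the central [c] and [d] to the left of the idempotents leaves only
    products of idempotents, and the two mixed ones vanish. *)
Lemma slice_product s x y c d : s * s = -1 ->
  (forall z, c * z = z * c) -> (forall z, d * z = z * d) ->
  (x * iota_plus s + y * iota_minus s) * (c * iota_plus s + d * iota_minus s)
  = x * c * iota_plus s + y * d * iota_minus s.
Proof.
move=> ss cC dC.
have swap u e z g : (forall w, z * w = w * z) ->
    u * e * (z * g) = u * z * (e * g) :> cquaternion R.
  by move=> zC; rewrite -!mulrA [e * (z * g)]mulrA -zC !mulrA.
rewrite mulrDr !mulrDl.
rewrite !(swap _ _ _ _ cC) !(swap _ _ _ _ dC) iota_plus_idem // iota_minus_idem //.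
by rewrite iota_plus_minus // iota_minus_plus // !mulr0 addr0 add0r.
Qed.

Lemma slice_inversion s x y : s * s = -1 ->
  (x * iota_plus s + y * iota_minus s) * iota_plus s
  + (x * iota_minus s + y * iota_plus s) * iota_minus s = x.
Proof.
move=> ss; rewrite !mulrDl -!mulrA iota_plus_idem // iota_minus_idem //.
rewrite iota_plus_minus // iota_minus_plus // !mulr0 !addr0.
by rewrite -mulrDr iota_sum mulr1.
Qed.

End Idempotents.

(** * Imaginary parts and quaternionic conjugation *)

Section ImaginaryPart.
Variable R : realType.
Implicit Types q : quaternion R.

Lemma quat_im_sqr q : quat_im q * quat_im q = - (quat_norm (quat_im q) ^+ 2)%:A.
Proof.
rewrite /quat_norm sqr_sqrtr ?addr_ge0 ?sqr_ge0 //=.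
by case: q => a b c d; congr Quaternion => /=; ring.
Qed.

Lemma quat_norm_im_neq0 q : quat_im q != 0 -> quat_norm (quat_im q) != 0.
Proof.
apply: contra_neq => /eqP; rewrite sqrtr_eq0 le_eqVlt ltNge.
rewrite ?addr_ge0 ?sqr_ge0 //= orbF expr0n /= add0r.
rewrite !paddr_eq0 ?addr_ge0 ?sqr_ge0 // !sqrf_eq0 /quat_im.
by move=> /andP[/andP[/eqP-> /eqP->] /eqP->].
Qed.

Lemma imaginary_unit_sqr q : quat_im q != 0 ->
  let s := (quat_norm (quat_im q))^-1 *: quat_im q in s * s = -1.
Proof.
move=> /quat_norm_im_neq0 n0 /=.
rewrite -scalerAl -scalerAr quat_im_sqr !scalerN !scalerA -expr2 exprVn.
by rewrite mulVf ?scale1r // expf_neq0.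
Qed.

Definition quat_conj q : quaternion R :=
  Quaternion (qre q) (- qj q) (- qk q) (- ql q).

Lemma quat_im_conj q : quat_im (quat_conj q) = - quat_im q.
Proof. by congr Quaternion; rewrite /= oppr0. Qed.

Lemma quat_norm_im_conj q :
  quat_norm (quat_im (quat_conj q)) = quat_norm (quat_im q).
Proof. by rewrite /quat_norm /= !sqrrN. Qed.

Lemma s_plus_conj q : s_plus (quat_conj q) = s_plus q.
Proof. by rewrite /s_plus quat_norm_im_conj. Qed.

Lemma s_minus_conj q : s_minus (quat_conj q) = s_minus q.
Proof. by rewrite /s_minus quat_norm_im_conj. Qed.

Lemma spectrum_conj q : spectrum (quat_conj q) = spectrum q.
Proof. by rewrite /spectrum s_plus_conj s_minus_conj. Qed.

End ImaginaryPart.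

(** * Products and inversion of slice extensions *)

Section SliceExtensionTheory.
Variables (R : realType) (U : set R[i]).
Implicit Types (F G : U -> cquaternion R) (p : spectral_domain U).

Lemma slice_ext_linear a F G p :
  slice_ext (a *: F + G) p = a *: slice_ext F p + slice_ext G p.
Proof.
rewrite /slice_ext; case: ifP => // _.
by rewrite scalerDr !scalerAl addrACA -!mulrDl.
Qed.

Lemma slice_ext1 p : slice_ext (fun=> 1) p = 1.
Proof. by rewrite /slice_ext; case: ifP => // _; rewrite !mul1r iota_sum. Qed.

Lemma slice_extM F (f : U -> R[i]) p :
  slice_ext (fun z => F z * complex_to_cquat (f z)) p =
  slice_ext F p * slice_ext (fun z => complex_to_cquat (f z)) p.
Proof.
rewrite /slice_ext; case: ifP => // /negbT im_n0.
by rewrite slice_product ?imaginary_unit_sqr // => z;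
  rewrite complex_to_cquat_central.
Qed.

Lemma slice_ext_conj F p p' : quat_im (val p) != 0 ->
    val p' = quat_conj (val p) ->
  let s := (quat_norm (quat_im (val p)))^-1 *: quat_im (val p) in
  slice_ext F p' =
  F (s_plus_in p) * iota_minus s + F (s_minus_in p) * iota_plus s.
Proof.
move=> im_n0 pp' /=.
have -> : s_plus_in p = s_plus_in p'.
  by apply: val_inj; rewrite /= pp' s_plus_conj.
have -> : s_minus_in p = s_minus_in p'.
  by apply: val_inj; rewrite /= pp' s_minus_conj.
rewrite /slice_ext pp' quat_im_conj oppr_eq0 (negbTE im_n0).
by rewrite -quat_im_conj quat_norm_im_conj quat_im_conj scalerN iota_plusN
  iota_minusN.
Qed.

(** The quaternionic conjugate has the same [s_plus] and [s_minus] but the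
    opposite imaginary unit: its slice value mixes the same two values of [F]
    with the idempotents exchanged, and the two values can be solved for. *)
Lemma slice_ext_inversion F p p' : quat_im (val p) != 0 ->
    val p' = quat_conj (val p) ->
  let s := (quat_norm (quat_im (val p)))^-1 *: quat_im (val p) in
  F (s_plus_in p) = slice_ext F p * iota_plus s + slice_ext F p' * iota_minus s.
Proof.
move=> im_n0 pp' /=; rewrite (slice_ext_conj F im_n0 pp').
by rewrite /slice_ext (negbTE im_n0) slice_inversion // imaginary_unit_sqr.
Qed.

End SliceExtensionTheory.

(** * Injectivity on saturated sets *)

Section StemMapTheory.
Variables (R : realType) (Omega : set (quaternion R)).
Local Notation U := (spectral_image Omega).
Implicit Types (F G : stemM U) (q : Omega).

Lemma quat_to_cquat_inj : injective (@quat_to_cquat R).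
Proof. by move=> p q []. Qed.

Lemma stem_map_eq_slice F G q : stem_map F q = stem_map G q ->
  slice_ext F (to_spectral_domain q) = slice_ext G (to_spectral_domain q).
Proof. by move=> eqFG; rewrite -!stem_mapE eqFG. Qed.

(** The inversion formula at [q] evaluates the slice extension at the
    conjugate of [q] too, a point of [Omega] by saturation, as it has the same
    spectrum.  At a real point the slice extension is [F] itself. *)
Lemma stem_map_eq_s_plus F G q : spectrally_saturated Omega ->
  stem_map F = stem_map G ->
  F (s_plus_in (to_spectral_domain q)) = G (s_plus_in (to_spectral_domain q)).
Proof.
move=> satO eqFG.
have eqS r := @stem_map_eq_slice F G r (congr1 (fun h => h r) eqFG).
have [im0|im_n0] := eqVneq (quat_im (val (to_spectral_domain q))) 0.
  by have := eqS q; rewrite /slice_ext im0 eqxx.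
have Oq' : Omega (quat_conj (val q)).
  exact: satO (set_mem (valP q)) (spectrum_conj _).
pose q' : Omega := SigSub (mem_set Oq').
rewrite !(@slice_ext_inversion _ _ _ _ (to_spectral_domain q')) //.
by rewrite !eqS.
Qed.

Lemma stem_map_inj : spectrally_saturated Omega ->
  injective (@stem_map R Omega).
Proof.
move=> satO F G eqFG; apply: val_inj; apply/funext => z /=.
have [q Oq zq] := set_mem (valP z).
pose q0 : Omega := SigSub (mem_set Oq).
have eqP0 := stem_map_eq_s_plus q0 satO eqFG.
case: zq => zq.
  by have -> : z = s_plus_in (to_spectral_domain q0) by exact: val_inj.
have /asboolP hF := valP F; have /asboolP hG := valP G.
have zc : val z = conjc (val (s_plus_in (to_spectral_domain q0))) by [].
by rewrite [LHS](hF _ _ zc) [RHS](hG _ _ zc) [X in cquat_conj X]eqP0.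
Qed.

End StemMapTheory.

Theorem theorem3 (R : realType) (Omega : set (quaternion R))
    (hOmega : spectrally_saturated Omega) :
  [/\ linear (@stem_map R Omega),
      injective (@stem_map R Omega),
      forall (F : stemM (spectral_image Omega)) (f : stemC (spectral_image Omega)),
        stem_map (F * stem_incl f) = stem_map F * stem_map (stem_incl f)
    & monoid_morphism
        (fun f : stemC (spectral_image Omega) => stem_map (stem_incl f))].
Proof.
have mapM (F : stemM (spectral_image Omega)) (f : stemC (spectral_image Omega)) :
    stem_map (F * stem_incl f) = stem_map F * stem_map (stem_incl f).
  apply/funext => q; apply: quat_to_cquat_inj.
  by rewrite [RHS]rmorphM /= !stem_mapE -slice_extM.
split=> //.
- move=> a F G; apply/funext => q; rewrite /stem_map.
  by rewrite [slice_ext _ _]slice_ext_linear.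
- exact: stem_map_inj.
split=> [|f g].
  apply/funext => q; apply: quat_to_cquat_inj.
  rewrite stem_mapE [RHS]rmorph1 -[RHS](slice_ext1 (to_spectral_domain q)).
  by congr (slice_ext _ _); apply/funext => z; rewrite /= rmorph1.
rewrite -mapM; congr stem_map; apply: val_inj; apply/funext => z.
exact: rmorphM.
Qed.
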